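(* Let $y>2$ and $m>1$ be natural numbers. Then the algorithm FindFloor$(y,m)$ (described in the context) determines a natural number $x$ such that $$x=\left\lfloor y^{1/m}\right\rfloor ,$$ i.e. on input $(y,m)$ the algorithm terminates and returns the integer $\lfloor y^{1/m}\rfloor$.
   Context: $\lg$ denotes the logarithm to base two. Initial value: $x_0=2^k$, where $k$ is an integer chosen so that $mk$ is a multiple of $m$ lying in the range $[\lg y,\ m+\lceil \lg y\rceil]$, i.e. $\lg y\le m\lg x_0\le m+\lceil\lg y\rceil$. (Hence $y^{1/m}\le x_0\le 2\cdot 2^{\lceil \lg y\rceil/m}\le 4y^{1/m}$.) CheckCandidateSolution$(x,y,m)$ returns YES if $x^m\le y$ and $y<(x+1)^m$, and NO otherwise. Algorithm FindFloor$(y,m)$: set $i=0$ and $x_0=2^k$, where $k$ is an integer with $\lg y\le mk\le m+\lceil\lg y\rceil$. Repeat the following loop. Compute $$x_{i+1}=x_i+\left\lfloor\frac{y-x_i^m}{m\,x_i^{m-1}}\right\rfloor .$$ Case 1: if $x_{i+1}=x_i$, then return $x_i$ if CheckCandidateSolution$(x_i,y,m)$ is YES; otherwise return $x_i+1$ if CheckCandidateSolution$(x_i+1,y,m)$ is YES. Case 2: if $i\ge 1$, $x_{i-1}>x_i$ and $x_i<x_{i+1}$, then return $x_i$ if CheckCandidateSolution$(x_i,y,m)$ is YES; otherwise return $x_i+1$ if CheckCandidateSolution$(x_i+1,y,m)$ is YES. Case 3: if $x_{i+1}<x_i$, replace $i$ by $i+1$ and continue with the next iteration of the loop. *)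

(* Defs.v *)
From Stdlib Require Import Reals ZArith.
Open Scope Z_scope.

Definition CheckCandidateSolution (x y m : Z) : bool :=
  (x ^ m <=? y) && (y <? (x + 1) ^ m).

(* [lg y <= m k <= m + ceil (lg y)], where [Rlog 2] is the base-two logarithm.
   If [1 < y] and [0 < m], this forces [0 < k], so the [Z] power [2 ^ k] below
   is the true one (it would be 0 for negative [k]). *)
Definition initial_exponent (y m k : Z) : Prop :=
  (Rlog 2 (IZR y) <= IZR (m * k))%R /\
  (m * k <= m + Zceil (Rlog 2 (IZR y))).

(* On [Z], [/] rounds towards minus infinity when the divisor is positive. *)
Definition newton_step (y m x : Z) : Z :=
  x + (y - x ^ m) / (m * x ^ (m - 1)).

Fixpoint iterate (y m k : Z) (i : nat) : Z :=
  match i with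
  | O => 2 ^ k
  | S j => newton_step y m (iterate y m k j)
  end.

(* [Abort]: the algorithm prescribes no action, or a division by zero. *)
Inductive outcome : Type :=
| Return (x : Z)
| Continue
| Abort.

Definition return_candidate (y m x : Z) : outcome :=
  if CheckCandidateSolution x y m then Return x
  else if CheckCandidateSolution (x + 1) y m then Return (x + 1)
  else Abort.

(* The pass through the loop with index [i]. *)
Definition loop_body (y m k : Z) (i : nat) : outcome :=
  let x := iterate y m k in
  if x i =? 0 then Abort
  else if x (S i) =? x i then return_candidate y m (x i)
  else if ((1 <=? i)%nat && (x i <? x (i - 1)%nat) && (x i <? x (S i)))%bool
  then return_candidate y m (x i)
  else if x (S i) <? x i then Continue
  else Abort.

(* FindFloor started from [2 ^ k] terminates, at loop index [n], with output [r]. *)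
Definition FindFloor_returns (y m k r : Z) : Prop :=
  exists n : nat,
    (forall i : nat, (i < n)%nat -> loop_body y m k i = Continue) /\
    loop_body y m k n = Return r.

(* Main.v *)
Require Import Defs.
From Stdlib Require Import Reals ZArith Lia Lra.
Open Scope Z_scope.

(** Write [r] for the floor of the [m]-th root of [y], that is, the only natural
    number with [r ^ m <= y < (r + 1) ^ m].  The graph of [x ^ m] lies above its
    tangents, so a Newton step from any [x > 0] lands on or above the real root;
    rounding down keeps it at or above the integer [r] ([newton_step_lower_bound]).
    The starting value [2 ^ k] is also at least the root, so no iterate ever falls
    below [r].

    While an iterate exceeds [r] it is at least [r + 1], its [m]-th power exceeds
    [y], and the rounded correction is at most [-1]: the pass falls in Case 3 and
    the sequence strictly decreases ([newton_step_lt]).  Hence it reaches [r]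
    exactly.  From [r] the correction is nonnegative, so the pass falls in Case 1
    or Case 2, and both return [r] ([loop_body_at_root]).  Case 2 asks for a
    preceding decrease.  If [r] is reached at a positive index, the preceding pass
    was a Case 3 and provides it; if [r] is the starting value itself, then
    [y <= r ^ m], so [y = r ^ m] and Case 1 applies. *)

(** * Newton steps on integers *)

(** Convexity of the power function: [x ^ m] lies above its tangent at [x].
    Replacing [m] by [m + 1] multiplies the gap by [r] and adds
    [m * x ^ (m - 1) * (r - x) ^ 2]. *)
Lemma pow_above_tangent (m x r : Z) :
  1 <= m -> 0 <= x -> 0 <= r -> m * x ^ (m - 1) * (r - x) <= r ^ m - x ^ m.
Proof.
  intros Hm Hx Hr.
  replace m with (Z.succ (m - 1)) by lia.
  assert (Hn : 0 <= m - 1) by lia.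
  revert Hn; generalize (m - 1); clear m Hm.
  intros n; revert n; apply natlike_ind.
  - cbn - [Z.mul]; lia.
  - intros n Hn IH.
    replace (Z.succ n - 1) with n in IH by lia.
    replace (Z.succ (Z.succ n) - 1) with (Z.succ n) by lia.
    rewrite (Z.pow_succ_r r (Z.succ n)), (Z.pow_succ_r x (Z.succ n)) by lia.
    rewrite !(Z.pow_succ_r x n) in * by lia.
    assert (Hpow : 0 <= x ^ n) by (apply Z.pow_nonneg; lia).
    set (a := r ^ Z.succ n) in *; set (b := x ^ n) in *.
    assert (Hgap : 0 <= r * (a - x * b - Z.succ n * b * (r - x)))
      by (apply Z.mul_nonneg_nonneg; lia).
    assert (Hsq : 0 <= Z.succ n * b * ((r - x) * (r - x)))
      by (apply Z.mul_nonneg_nonneg;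
          [apply Z.mul_nonneg_nonneg; lia | apply Z.square_nonneg]).
    unfold Z.succ in *; nia.
Qed.

Lemma derivative_pos (m x : Z) : 1 <= m -> 0 < x -> 0 < m * x ^ (m - 1).
Proof.
  intros Hm Hx; apply Z.mul_pos_pos; [lia | apply Z.pow_pos_nonneg; lia].
Qed.

Lemma newton_step_lower_bound (y m x r : Z) :
  1 <= m -> 0 < x -> 0 <= r -> r ^ m <= y -> r <= newton_step y m x.
Proof.
  intros Hm Hx Hr Hry; unfold newton_step.
  assert (Hdiv : r - x <= (y - x ^ m) / (m * x ^ (m - 1))).
  { apply Z.div_le_lower_bound; [now apply derivative_pos |].
    pose proof (pow_above_tangent m x r Hm); lia. }
  lia.
Qed.

(** Rounding down turns any negative correction, however small, into at most
    [-1]; this is what makes the descent strict. *)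
Lemma newton_step_lt (y m x : Z) :
  1 <= m -> 0 < x -> y < x ^ m -> newton_step y m x < x.
Proof.
  intros Hm Hx Hlt; unfold newton_step.
  assert (Hdiv : (y - x ^ m) / (m * x ^ (m - 1)) < 0)
    by (apply Z.div_lt_upper_bound; [now apply derivative_pos | lia]).
  lia.
Qed.

Lemma newton_step_fixed (m x : Z) : newton_step (x ^ m) m x = x.
Proof.
  unfold newton_step; rewrite Z.sub_diag, Zdiv_0_l; lia.
Qed.

(** * The loop *)

Lemma check_candidate_spec (x y m : Z) :
  CheckCandidateSolution x y m = true <-> x ^ m <= y < (x + 1) ^ m.
Proof.
  unfold CheckCandidateSolution.
  rewrite Bool.andb_true_iff, Z.leb_le, Z.ltb_lt; reflexivity.
Qed.

Lemma loop_body_above_root (y m k r : Z) (i : nat) :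
  1 <= m -> 0 < r -> r ^ m <= y < (r + 1) ^ m -> r < iterate y m k i ->
  loop_body y m k i = Continue.
Proof.
  intros Hm Hr [_ Hry] Hi.
  assert (Hlt : iterate y m k (S i) < iterate y m k i).
  { apply newton_step_lt; [lia | lia |].
    apply Z.lt_le_trans with (1 := Hry), Z.pow_le_mono_l; lia. }
  unfold loop_body; cbv zeta.
  destruct (Z.eqb_spec (iterate y m k i) 0); [lia |].
  destruct (Z.eqb_spec (iterate y m k (S i)) (iterate y m k i)); [lia |].
  destruct (Z.ltb_spec (iterate y m k i) (iterate y m k (S i))); [lia |].
  rewrite Bool.andb_false_r.
  now destruct (Z.ltb_spec (iterate y m k (S i)) (iterate y m k i)); [| lia].
Qed.

Lemma continue_descends (y m k : Z) (i : nat) :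
  loop_body y m k i = Continue -> iterate y m k (S i) < iterate y m k i.
Proof.
  unfold loop_body, return_candidate; cbv zeta; intros H.
  destruct (Z.ltb_spec (iterate y m k (S i)) (iterate y m k i)); [assumption |].
  repeat match type of H with
         | (if ?b then _ else _) = _ => destruct b
         end; discriminate.
Qed.

(** The two hypotheses on how [r] was reached guarantee that a pass that moves up
    from [r] meets the descent condition of Case 2. *)
Lemma loop_body_at_root (y m k r : Z) (i : nat) :
  1 <= m -> 0 < r -> r ^ m <= y < (r + 1) ^ m ->
  y <= (2 ^ k) ^ m ->
  (forall j : nat, (j < i)%nat -> loop_body y m k j = Continue) ->
  iterate y m k i = r ->
  loop_body y m k i = Return r.
Proof.
  intros Hm Hr Hroot Hinit Hprev Hi.
  assert (Hret : return_candidate y m r = Return r).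
  { unfold return_candidate.
    now rewrite (proj2 (check_candidate_spec r y m) Hroot). }
  assert (Hge : r <= iterate y m k (S i)).
  { simpl; rewrite Hi; apply newton_step_lower_bound; lia. }
  unfold loop_body; cbv zeta; rewrite Hi.
  destruct (Z.eqb_spec r 0); [lia |].
  destruct (Z.eqb_spec (iterate y m k (S i)) r) as [_ | Hmove]; [exact Hret |].
  destruct i as [| i].
  - exfalso; apply Hmove.
    simpl in Hi |- *; rewrite Hi in *.
    replace y with (r ^ m) by lia; apply newton_step_fixed.
  - assert (Hdesc : iterate y m k (S i) < iterate y m k i)
      by (apply continue_descends, Hprev; lia).
    rewrite Hi in Hdesc.
    replace (S i - 1)%nat with i by lia.
    destruct (Z.ltb_spec r (iterate y m k i)); [| lia].
    destruct (Z.ltb_spec r (iterate y m k (S (S i)))); [exact Hret | lia].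
Qed.

(** [d] bounds the distance left to [r]; it drops by at least one at each pass
    that does not return. *)
Lemma descent_reaches_root (y m k r : Z) (d i : nat) :
  1 <= m -> 0 < r -> r ^ m <= y < (r + 1) ^ m ->
  y <= (2 ^ k) ^ m ->
  (forall j : nat, (j < i)%nat -> loop_body y m k j = Continue) ->
  r <= iterate y m k i <= r + Z.of_nat d ->
  FindFloor_returns y m k r.
Proof.
  intros Hm Hr Hroot Hinit; revert i.
  induction d as [| d IH]; intros i Hprev Hi;
    (destruct (Z.eq_dec (iterate y m k i) r) as [Heq | Hne];
     [exists i; split; [exact Hprev | now apply loop_body_at_root] |]).
  - lia.
  - assert (Hcont : loop_body y m k i = Continue)
      by (apply (loop_body_above_root y m k r); lia).
    pose proof (continue_descends y m k i Hcont) as Hdesc.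
    apply (IH (S i)).
    + intros j Hj.
      destruct (Nat.eq_dec j i) as [-> | Hji]; [exact Hcont | apply Hprev; lia].
    + assert (r <= iterate y m k (S i))
        by (simpl; apply newton_step_lower_bound; lia).
      lia.
Qed.

Lemma FindFloor_returns_root (y m k r : Z) :
  1 <= m -> 0 < r -> 0 <= k -> r ^ m <= y < (r + 1) ^ m ->
  y <= (2 ^ k) ^ m ->
  FindFloor_returns y m k r.
Proof.
  intros Hm Hr Hk Hroot Hinit.
  assert (Hr0 : r <= 2 ^ k).
  { apply (Z.pow_le_mono_l_iff r (2 ^ k) m); lia. }
  apply (descent_reaches_root y m k r (Z.to_nat (2 ^ k - r)) 0);
    [assumption .. | intros j Hj; lia | simpl; lia].
Qed.

(** * The starting value *)

Lemma Rlog2_pos (y : Z) : 1 < y -> (0 < Rlog 2 (IZR y))%R.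
Proof.
  intros Hy; apply IZR_lt in Hy; unfold Rlog.
  apply Rdiv_lt_0_compat; rewrite <- ln_1; apply ln_increasing; lra.
Qed.

(** The interval prescribed for [m * k] has length at least [m], so it contains
    a multiple of [m]; the ceiling of [lg y / m] gives the least one. *)
Lemma initial_exponent_exists (y m : Z) :
  0 < m -> exists k : Z, initial_exponent y m k.
Proof.
  intros Hm; unfold initial_exponent.
  assert (HmR : (0 < IZR m)%R) by now apply IZR_lt.
  set (L := Rlog 2 (IZR y)).
  exists (Zceil (L / IZR m)).
  pose proof (Zceil_bound (L / IZR m)) as [Hlo Hhi].
  pose proof (Zceil_bound L) as [_ HL].
  assert (HLm : (L = IZR m * (L / IZR m))%R) by (field; lra).
  split.
  - rewrite mult_IZR; nra.
  - apply le_IZR; rewrite plus_IZR, mult_IZR; nra.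
Qed.

(** Since [lg y > 0], the left end of the interval forces [k > 0], and then
    exponentiating [lg y <= m * k] gives the bound as one between integers. *)
Lemma initial_value_bound (y m k : Z) :
  1 < y -> 0 < m -> initial_exponent y m k -> 0 < k /\ y <= (2 ^ k) ^ m.
Proof.
  intros Hy Hm [Hlog _].
  pose proof (Rlog2_pos y Hy) as Hpos.
  assert (Hmk : 0 < m * k) by (apply lt_IZR; lra).
  assert (Hk : 0 < k) by nia.
  split; [exact Hk |].
  rewrite <- Z.pow_mul_r, Z.mul_comm by lia.
  assert (HyR : (1 < IZR y)%R) by now apply IZR_lt.
  apply le_IZR.
  rewrite <- (Z2Nat.id (m * k)) in * by lia.
  rewrite <- pow_IZR, <- Rpower_pow by lra.
  rewrite <- (Rpower_Rlog 2 (IZR y)) by lra.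
  rewrite <- INR_IZR_INZ in Hlog.
  apply Rle_Rpower; lra.
Qed.

(** * The floor of the real root *)

Lemma Rpower_inv_pow (a : R) (m : nat) :
  (0 < a)%R -> (0 < m)%nat -> (Rpower a (1 / INR m) ^ m)%R = a.
Proof.
  intros Ha Hm.
  rewrite <- Rpower_pow by apply exp_pos.
  rewrite Rpower_mult.
  replace (1 / INR m * INR m)%R with 1%R
    by (field; apply not_0_INR; lia).
  now apply Rpower_1.
Qed.

(** Passes from the real power in the specification to the integer inequalities
    that the candidate check tests. *)
Lemma Zfloor_root_spec (y m : nat) :
  (1 <= y)%nat -> (0 < m)%nat ->
  let r := Zfloor (Rpower (INR y) (1 / INR m)) in
  0 < r /\ r ^ Z.of_nat m <= Z.of_nat y < (r + 1) ^ Z.of_nat m.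
Proof.
  intros Hy Hm r.
  assert (HyR : (1 <= INR y)%R) by (apply (le_INR 1); lia).
  set (rho := Rpower (INR y) (1 / INR m)) in *.
  assert (Hpow : (rho ^ m)%R = INR y) by (apply Rpower_inv_pow; lra || lia).
  assert (Hrho : (1 <= rho)%R).
  { unfold rho; rewrite <- (Rpower_O (INR y)) at 1 by lra.
    apply Rle_Rpower; [lra |].
    apply Rlt_le, Rdiv_lt_0_compat; [lra | apply lt_0_INR; lia]. }
  pose proof (Zfloor_bound rho) as [Hlo Hhi]; fold r in Hlo, Hhi.
  assert (Hr : 1 <= r) by (apply Zfloor_lub; exact Hrho).
  assert (HrR : (1 <= IZR r)%R) by now apply IZR_le.
  split; [lia | split].
  - apply le_IZR; rewrite <- pow_IZR, <- INR_IZR_INZ, <- Hpow.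
    apply pow_incr; lra.
  - apply lt_IZR; rewrite <- pow_IZR, <- INR_IZR_INZ, <- Hpow, plus_IZR.
    rewrite <- !Rpower_pow by lra.
    apply Rlt_Rpower_l; [apply lt_0_INR; lia | lra].
Qed.

Theorem lemma1 (y m : nat) (hy : (2 < y)%nat) (hm : (1 < m)%nat) :
  (exists k : Z, initial_exponent (Z.of_nat y) (Z.of_nat m) k) /\
  (forall k : Z, initial_exponent (Z.of_nat y) (Z.of_nat m) k ->
     exists x : nat,
       FindFloor_returns (Z.of_nat y) (Z.of_nat m) k (Z.of_nat x) /\
       Z.of_nat x = Zfloor (Rpower (INR y) (1 / INR m))).
Proof.
  split.
  - apply initial_exponent_exists; lia.
  - intros k Hk.
    destruct (Zfloor_root_spec y m) as [Hr Hroot]; [lia | lia |].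
    destruct (initial_value_bound (Z.of_nat y) (Z.of_nat m) k)
      as [Hk0 Hinit]; [lia | lia | exact Hk |].
    exists (Z.to_nat (Zfloor (Rpower (INR y) (1 / INR m)))).
    rewrite Z2Nat.id by lia.
    split; [apply FindFloor_returns_root; lia | reflexivity].
Qed.
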